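(* Let $F$ be a compact, totally disconnected subset of $\mathbb R$ with no isolated points, with convex hull $[a,b]$. For each $n$ let $\mathcal F_n$ be a family of closed intervals (filled intervals of level $n$) and $\mathcal L_n$ a family of open intervals (lacunary intervals of level $n$) such that - $F=\bigcap_n\bigcup_{I\in\mathcal F_n}I$, - $\mathcal L_n\subseteq\mathcal L_{n+1}$ for every $n$, - $\mathcal I_n:=\mathcal F_n\cup\mathcal L_n$ is a finite partition of $[a,b]$ for every $n$. Set $\mathcal I=\bigcup_n\mathcal I_n$, $\mathcal H=\bigoplus_{I\in\mathcal I}\mathcal H(I)$, $D=\bigoplus_{I\in\mathcal I}D(I)$, and let $\mathcal A$ be the $*$-algebra of Lipschitz functions on $F$. Then the spectral triple $(\mathcal A,\mathcal H,D)$ reconstructs the original distance on $F$: for all $x,y\in F$, $$\sup\{|f(x)-f(y)|:\ f\in\mathcal A,\ \|[D,f]\|\le1\}=|x-y|.$$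
   Context: For a bounded interval $I$, $\mathcal H(I)=\ell^2(\partial I)$ and $D(I)=\frac1{|I|}\begin{pmatrix}0&1\\1&0\end{pmatrix}$. A function $f$ on $F$ acts on $\mathcal H$ by pointwise multiplication on each $\ell^2(\partial I)$ (the endpoints of all intervals in $\mathcal I$ belong to $F$). $F$ is nonempty. *)

(* Defs.v *)
From mathcomp Require Export all_boot all_order all_algebra.
From mathcomp Require Export complex.
From mathcomp Require Export all_classical all_reals all_analysis.

Set Implicit Arguments.
Unset Strict Implicit.
Unset Printing Implicit Defensive.

Export Order.TTheory GRing.Theory Num.Theory.
Export numFieldNormedType.Exports.

Local Open Scope classical_set_scope.
Local Open Scope ring_scope.

Definition convex_hull (R : realType) (A : set R) : set R :=
  smallest (@convex_set R R^o) A.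

Definition itv_length (R : realType) (I : interval R) : R :=
  sup [set` I] - inf [set` I].

(* The boundary of a bounded interval is listed as left endpoint (index 0)
   then right endpoint (index 1), so that ℓ²(∂I) is identified with 'cV_2. *)
Definition endpoint (R : realType) (I : interval R) (i : 'I_2) : R :=
  if i == 0 then inf [set` I] else sup [set` I].

(* A vector of ⨁_I ℓ²(∂I), before the conditions on its support and on
   square-summability, which are in [hilbert]. *)
Definition hvec (R : realType) : Type := interval R -> 'cV[R[i]]_2.

Definition hnorm (R : realType) (cI : set (interval R)) (xi : hvec R) : \bar R :=
  sqrte (\esum_(I in cI) (\sum_(i < 2) ComplexField.Normc.normc (xi I i 0) ^+ 2)%:E).

Definition hilbert (R : realType) (cI : set (interval R)) : set (hvec R) :=
  [set xi | (forall I, ~ cI I -> xi I = 0) /\ (hnorm cI xi < +oo)%E].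

Definition D_itv (R : realType) (I : interval R) : 'M[R[i]]_2 :=
  ((itv_length I)^-1)%:C%C *: \matrix_(i < 2, j < 2) (i != j)%:R.

Definition dirac_op (R : realType) (xi : hvec R) : hvec R :=
  fun I => D_itv I *m xi I.

(* The maximal domain; the direct sum is self-adjoint on it. *)
Definition dirac_dom (R : realType) (cI : set (interval R)) : set (hvec R) :=
  [set xi | hilbert cI xi /\ hilbert cI (dirac_op xi)].

(* Functions on F are represented by their extensions to R; only the values
   at points of F matter, since all the endpoints are in F. *)
Definition mul_op (R : realType) (f : R -> R[i]) (xi : hvec R) : hvec R :=
  fun I => \col_(i < 2) (f (endpoint I i) * xi I i 0).

Definition comm_dom (R : realType) (cI : set (interval R)) (f : R -> R[i]) :
    set (hvec R) :=
  [set xi | dirac_dom cI xi /\ dirac_dom cI (mul_op f xi)].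

Definition comm_op (R : realType) (f : R -> R[i]) (xi : hvec R) : hvec R :=
  fun I => dirac_op (mul_op f xi) I - mul_op f (dirac_op xi) I.

Definition opnorm (R : realType) (cI : set (interval R)) (dom : set (hvec R))
    (T : hvec R -> hvec R) : \bar R :=
  ereal_sup [set hnorm cI (T xi) | xi in [set xi | dom xi /\ (hnorm cI xi <= 1)%E]].

(* The Lipschitz functions are complex-valued; normc is the R-valued modulus. *)
Definition lipschitz_fun (R : realType) (F : set R) : set (R -> R[i]) :=
  [set f | exists k : R, forall x y, F x -> F y ->
     ComplexField.Normc.normc (f x - f y) <= k * `|x - y|].

(* Main.v *)
(* The commutator [D, f] acts on l^2(dI), for I with endpoints u and v, with norm
   |f v - f u| / |I|; hence ||[D, f]|| <= 1 iff |f v - f u| <= |I| for every I,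
   and the identity function gives one inequality.  For the other one, let
   x < y in F.  Total disconnectedness yields points outside F just to the right
   of x and just to the left of y; at a level n where neither lies in a filled
   interval, the filled intervals containing x and y end at p near x and begin
   at q near y.  Any two consecutive endpoints of level n bound an interval of
   that level, so |f q - f p| <= q - p by the triangle inequality; as p and q
   are in F, the Lipschitz bound controls |f p - f x| and |f y - f q|. *)

Require Import Defs.
From mathcomp Require Import ring lra.

Set Implicit Arguments.
Unset Strict Implicit.
Unset Printing Implicit Defensive.

Local Open Scope classical_set_scope.
Local Open Scope ring_scope.

(** * Moduli, block norms and the norm of the commutator *)

Local Notation normc := ComplexField.Normc.normc.

Lemma normc_real (R : rcfType) (x : R) : normc x%:C%C = `|x|.
Proof. by rewrite /= expr0n addr0 sqrtr_sqr. Qed.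

Lemma normc_ge0 (R : rcfType) (z : R[i]) : 0 <= normc z.
Proof. by case: z => p q; exact: sqrtr_ge0. Qed.

Lemma normc_distC (R : rcfType) (z w : R[i]) : normc (z - w) = normc (w - z).
Proof. by rewrite -opprB; exact: normcN. Qed.

Lemma normc_distD (R : rcfType) (z w t : R[i]) :
  normc (z - t) <= normc (z - w) + normc (w - t).
Proof.
have -> : z - t = (z - w) + (w - t) by rewrite addrA subrK.
exact: le_normcD.
Qed.

Definition sqnorm (R : realType) (v : 'cV[R[i]]_2) : R :=
  \sum_(i < 2) normc (v i 0) ^+ 2.

Lemma sqnorm_ge0 (R : realType) (v : 'cV[R[i]]_2) : 0 <= sqnorm v.
Proof. by apply: sumr_ge0 => i _; exact: sqr_ge0. Qed.

(** [D_itv I] has zero diagonal, so only the other coordinate survives; [rev_ord] exchanges the two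
    indices of ['I_2]. *)
Lemma comm_opE (R : realType) (f : R -> R[i]) (xi : hvec R) I (i : 'I_2) :
  comm_op f xi I i 0 = ((itv_length I)^-1)%:C%C *
    (f (endpoint I (rev_ord i)) - f (endpoint I i)) * xi I (rev_ord i) 0.
Proof.
have E : rev_ord (ord0 : 'I_2) = lift ord0 ord0 by apply/val_inj.
have E' : rev_ord (lift ord0 ord0 : 'I_2) = ord0 by apply/val_inj.
rewrite /comm_op /dirac_op /mul_op /D_itv !mxE !big_ord_recl !big_ord0 !mxE.
case: i => -[|[|//]] p.
- by rewrite (_ : Ordinal p = ord0) ?E; [|exact/val_inj]; rewrite /=; ring.
- rewrite (_ : Ordinal p = lift ord0 ord0) ?E'; last exact/val_inj.
  by rewrite /=; ring.
Qed.

(** The two off-diagonal entries of the commutator are opposite, hence of equal modulus: on each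
    block it is a multiple of an isometry. *)
Lemma sqnorm_comm_op (R : realType) (f : R -> R[i]) (xi : hvec R) I :
  sqnorm (comm_op f xi I) =
  (`|(itv_length I)^-1| * normc (f (sup [set` I]) - f (inf [set` I]))) ^+ 2 *
  sqnorm (xi I).
Proof.
have E : rev_ord (ord0 : 'I_2) = lift ord0 ord0 by apply/val_inj.
have E' : rev_ord (lift ord0 ord0 : 'I_2) = ord0 by apply/val_inj.
rewrite /sqnorm !big_ord_recl !big_ord0 !comm_opE E E' /endpoint.
rewrite !ComplexField.Normc.normcM normc_real /=.
rewrite (normc_distC (f (inf _))); ring.
Qed.

Lemma hnormE (R : realType) (cI : set (interval R)) (xi : hvec R) :
  hnorm cI xi = sqrte (\esum_(I in cI) (sqnorm (xi I))%:E).
Proof. by []. Qed.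

Lemma le_hnorm (R : realType) (cI : set (interval R)) (xi eta : hvec R) :
  (forall I, cI I -> sqnorm (xi I) <= sqnorm (eta I)) ->
  (hnorm cI xi <= hnorm cI eta)%E.
Proof.
move=> le_xi_eta; rewrite !hnormE lee_sqrt.
  by apply: le_esum => I /le_xi_eta; rewrite lee_fin.
by apply: esum_ge0 => I _; rewrite lee_fin sqnorm_ge0.
Qed.

Lemma sqnorm0 (R : realType) : sqnorm (0 : 'cV[R[i]]_2) = 0.
Proof.
by rewrite /sqnorm big1// => i _; rewrite mxE ComplexField.Normc.normc0 expr0n.
Qed.

(** For test vectors living on a single block: the sum over [cI] has only one nonzero term. *)
Lemma hnorm_supp1 (R : realType) (cI : set (interval R)) I (xi : hvec R) :
  cI I -> (forall J, J <> I -> xi J = 0) ->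
  hnorm cI xi = (Num.sqrt (sqnorm (xi I)))%:E.
Proof.
move=> cII xi0; rewrite hnormE.
rewrite (_ : (\esum_(J in cI) _)%E = (sqnorm (xi I))%:E)//.
rewrite -(@esum_set1 _ _ I (fun J => (sqnorm (xi J))%:E)); last first.
  by rewrite lee_fin sqnorm_ge0.
rewrite (_ : [set I] = cI `&` [set I]); last first.
  by apply/seteqP; split=> [J ->|J []].
rewrite esum_mkcondr; apply: eq_esum => J _.
case: ifPn => // /negP; rewrite in_setE /= => JI.
by rewrite xi0// sqnorm0.
Qed.

Lemma hilbert_supp1 (R : realType) (cI : set (interval R)) I (xi : hvec R) :
  cI I -> (forall J, J <> I -> xi J = 0) -> hilbert cI xi.
Proof.
move=> cII xi0; split; last by rewrite (hnorm_supp1 cII xi0) ltry.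
by move=> J cIJ; apply: xi0 => JI; rewrite JI in cIJ.
Qed.

Lemma opnorm_comm_id (R : realType) (cI : set (interval R)) :
  (opnorm cI (comm_dom cI (fun x : R => x%:C%C))
             (comm_op (fun x : R => x%:C%C)) <= 1)%E.
Proof.
apply: ge_ereal_sup => _ [xi [_ xi1] <-]; apply: le_trans xi1.
apply: le_hnorm => I _; rewrite sqnorm_comm_op ler_piMl ?sqnorm_ge0//.
rewrite -raddfB normc_real -normrM real_normK ?num_real//.
rewrite -/(itv_length I).
(* The factor is 1, except on a degenerate interval, where it is 0. *)
by have [->|I0] := eqVneq (itv_length I) 0; rewrite ?mulr0 ?expr0n ?mulVf ?expr1n.
Qed.

Lemma opnorm_comm_le1 (R : realType) (cI : set (interval R)) (f : R -> R[i]) I :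
  (opnorm cI (comm_dom cI f) (comm_op f) <= 1)%E -> cI I ->
  0 < itv_length I ->
  normc (f (sup [set` I]) - f (inf [set` I])) <= itv_length I.
Proof.
move=> f1 cII I0.
(* The test vector is the unit mass at the left endpoint of [I]. [D0] and [M0] keep supports inside
   the block [I], which settles all domain conditions. *)
pose xi : hvec R := fun J => if J == I then delta_mx 0 0 else 0.
have xi0 J : J <> I -> xi J = 0 by rewrite /xi; case: eqP.
have D0 (eta : hvec R) : (forall J, J <> I -> eta J = 0) ->
    forall J, J <> I -> dirac_op eta J = 0.
  by move=> h J /h; rewrite /dirac_op => ->; rewrite mulmx0.
have M0 (eta : hvec R) : (forall J, J <> I -> eta J = 0) ->
    forall J, J <> I -> mul_op f eta J = 0.
  move=> h J /h; rewrite /mul_op => ->.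
  by apply/matrixP => i j; rewrite !mxE mulr0.
have xiI : sqnorm (xi I) = 1.
  rewrite /sqnorm !big_ord_recl big_ord0 /xi eqxx !mxE /=.
  by rewrite !expr1n !expr0n !addr0 sqrtr1 sqrtr0 expr1n expr0n addr0.
have C0 J : J <> I -> comm_op f xi J = 0.
  by move=> JI; rewrite /comm_op D0 ?M0 ?subrr//; [exact: D0|exact: M0].
have : (hnorm cI (comm_op f xi) <= 1)%E.
  apply: le_trans f1; apply: ereal_sup_ubound; exists xi => //; split.
    by split; split; apply: (hilbert_supp1 cII); do ?[exact: xi0|apply: D0|apply: M0].
  by rewrite (hnorm_supp1 cII xi0) xiI sqrtr1.
rewrite (hnorm_supp1 cII C0) sqnorm_comm_op xiI mulr1 sqrtr_sqr.
rewrite lee_fin normrM normr_id !ger0_norm ?normc_ge0 ?invr_ge0 ?(ltW I0)//.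
by rewrite mulrC ler_pdivrMr// mul1r.
Qed.

(** * Endpoints of a partition into closed and open intervals *)

Definition endpoints (R : realType) (P : set (interval R)) : set R :=
  [set inf [set` I] | I in P] `|` [set sup [set` I] | I in P].

Lemma finite_endpoints (R : realType) (P : set (interval R)) :
  finite_set P -> finite_set (endpoints P).
Proof. by move=> finP; rewrite finite_setU; split; exact: finite_image. Qed.

Definition closed_or_open (R : realType) (I : interval R) : Prop :=
  exists u v : R, I = `[u, v] \/ I = `]u, v[.

(** Recovers [I] from its infimum and supremum, the only data that [endpoint] retains; nonemptiness
    makes the bounds ordered, strictly so in the open case. *)
Lemma closed_or_openP (R : realType) (I : interval R) :
  closed_or_open I -> [set` I] !=set0 ->
  inf [set` I] <= sup [set` I] /\
  (I = `[inf [set` I], sup [set` I]] \/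
   inf [set` I] < sup [set` I] /\ I = `]inf [set` I], sup [set` I][).
Proof.
move=> [u [v [->|->]]] [t]; rewrite /= in_itv /= => /andP[ut tv].
  have uv := le_trans ut tv.
  by rewrite inf_itv ?bnd_simp// sup_itv ?bnd_simp//; split=> //; left.
have uv := lt_trans ut tv.
rewrite inf_itv ?bnd_simp// sup_itv ?bnd_simp//; split; first exact: ltW.
by right.
Qed.

Lemma mem_between_ends (R : realType) (I : interval R) (t : R) :
  closed_or_open I -> [set` I] !=set0 ->
  inf [set` I] < t < sup [set` I] -> t \in I.
Proof.
move=> cI I0 /andP[ut tv].
by have [_ [->|[_ ->]]] := closed_or_openP cI I0; rewrite in_itv/= ?ut ?ltW.
Qed.

Lemma mem_ends_le (R : realType) (I : interval R) (t : R) :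
  closed_or_open I -> t \in I -> inf [set` I] <= t <= sup [set` I].
Proof.
move=> cI It; have I0 : [set` I] !=set0 by exists t.
move: It; have [_ [E|[_ E]]] := closed_or_openP cI I0; rewrite {1}E in_itv//=.
by move=> /andP[? ?]; rewrite !ltW.
Qed.

Lemma endpoint_adherent (R : realType) (I : interval R) (e c d : R) :
  closed_or_open I -> [set` I] !=set0 ->
  e = inf [set` I] \/ e = sup [set` I] -> c < e < d ->
  exists2 t, t \in I & c < t < d.
Proof.
move=> cI I0; have [] := closed_or_openP cI I0.
set u := inf _; set v := sup _ => uv Iuv eE /andP[ce ed].
have [I_closed|[u_lt_v I_open]] := Iuv.
  exists e; last by rewrite ce.
  by rewrite I_closed in_itv/=; case: eE => ->; rewrite lexx ?uv// andbT.
case: eE => eE; rewrite {}eE in ce ed; rewrite I_open.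
(* An open interval misses its endpoints, so the witness is a midpoint: it stays in [I] and on the
   right side of [c] and [d]. *)
- have umin : u < Num.min v d by rewrite lt_min u_lt_v.
  have := midf_lt umin; rewrite lt_min => -[ut /andP[tv td]].
  by exists ((u + Num.min v d) / 2); rewrite ?in_itv/= ?ut ?(lt_trans ce ut).
- have maxv : Num.max u c < v by rewrite gt_max u_lt_v.
  have := midf_lt maxv; rewrite gt_max => -[/andP[ut ct] tv].
  by exists ((Num.max u c + v) / 2); rewrite ?in_itv/= ?tv ?ut ?ct ?(lt_trans tv ed).
Qed.

Lemma trivIset_itv_eq (R : realType) (P : set (interval R)) I J (t : R) :
  trivIset P (fun I => [set` I]) -> P I -> P J -> t \in I -> t \in J -> I = J.
Proof. by move=> tP PI PJ It Jt; apply: tP => //; exists t. Qed.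

(** If [e] is an endpoint of [J], points of [J] close to [e] would lie in [I]; disjointness gives
    [J = I], whose own endpoints are not strictly between themselves. *)
Lemma endpoint_not_between (R : realType) (P : set (interval R)) I (e : R) :
  trivIset P (fun I => [set` I]) ->
  (forall I, P I -> closed_or_open I /\ [set` I] !=set0) ->
  P I -> endpoints P e -> ~ inf [set` I] < e < sup [set` I].
Proof.
move=> tP coP PI Ee ueV; have [cI I0] := coP _ PI.
have [J PJ eJ] : exists2 J, P J & e = inf [set` J] \/ e = sup [set` J].
  by case: Ee => -[J PJ <-]; exists J => //; [left|right].
have [cJ J0] := coP _ PJ.
have [t Jt /(mem_between_ends cI I0) It] := endpoint_adherent cJ J0 eJ ueV.
have IJ := trivIset_itv_eq tP PI PJ It Jt.
by move: ueV; rewrite IJ; case: eJ => ->; rewrite ltxx ?andbF.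
Qed.

Lemma endpoint_le (R : realType) (P : set (interval R)) a b (e : R) :
  partition P (fun I => [set` I]) [set` `[a, b]] ->
  (forall I, P I -> closed_or_open I) ->
  endpoints P e -> a <= e <= b.
Proof.
move=> [covP _ P0] cP Ee.
have [I PI eI] : exists2 I, P I & e = inf [set` I] \/ e = sup [set` I].
  by case: Ee => -[I PI <-]; exists I => //; [left|right].
have near_e c d : c < e < d -> exists2 t, a <= t <= b & c < t < d.
  move=> /(endpoint_adherent (cP _ PI) (P0 _ PI) eI)[t It tcd]; exists t => //.
  suff : [set` `[a, b]] t by rewrite /= in_itv.
  by rewrite -covP; exists I.
(* If [e] were outside [[a, b]], a window around [e] missing [[a, b]] would still contain a point of
   the interval. *)
apply/andP; split; rewrite leNgt; apply/negP => e_out.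
  have [t] : exists2 t, a <= t <= b & e - 1 < t < a by apply: near_e; lra.
  by lra.
have [t] : exists2 t, a <= t <= b & b < t < e + 1 by apply: near_e; lra.
by lra.
Qed.

(** Take the interval containing the midpoint of [p] and [q]. Its endpoints are not strictly between
    [p] and [q], and neither [p] nor [q] is strictly between its endpoints. *)
Lemma consecutive_endpoints (R : realType) (P : set (interval R)) a b p q :
  partition P (fun I => [set` I]) [set` `[a, b]] ->
  (forall I, P I -> closed_or_open I) ->
  endpoints P p -> endpoints P q -> a <= p -> p < q -> q <= b ->
  (forall e, endpoints P e -> ~ p < e < q) ->
  exists I, [/\ P I, inf [set` I] = p & sup [set` I] = q].
Proof.
move=> [covP tP P0] cP Ep Eq ap pq qb nopq.
have coP I : P I -> closed_or_open I /\ [set` I] !=set0.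
  by move=> PI; split; [exact: cP|exact: P0].
have [pm mq] := midf_lt pq; set m := (p + q) / 2 in pm mq.
have : cover P (fun I => [set` I]) m.
  by rewrite covP /= in_itv/= (ltW (le_lt_trans ap pm)) (ltW (lt_le_trans mq qb)).
move=> [I PI /= Im]; have /andP[um mv] := mem_ends_le (cP _ PI) Im.
have up : inf [set` I] <= p.
  rewrite leNgt; apply/negP => pu; apply: (nopq (inf [set` I])).
    by left; exists I.
  by rewrite pu (le_lt_trans um mq).
have qv : q <= sup [set` I].
  rewrite leNgt; apply/negP => vq; apply: (nopq (sup [set` I])).
    by right; exists I.
  by rewrite vq (lt_le_trans pm mv).
exists I; split => //; apply: le_anti; rewrite ?up ?qv /=.
  rewrite leNgt; apply/negP => up'.
  by apply: (endpoint_not_between tP coP PI Ep); rewrite up' (lt_le_trans pq).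
rewrite leNgt andbT; apply/negP => qv'.
by apply: (endpoint_not_between tP coP PI Eq); rewrite qv' (le_lt_trans _ pq).
Qed.

Lemma count_lt_subpred (T : eqType) (P Q : pred T) (s : seq T) (x : T) :
  subpred P Q -> x \in s -> Q x -> ~~ P x -> (count P s < count Q s)%N.
Proof.
move=> PQ /perm_to_rem/permP E Qx /negPf Px.
by rewrite !E /= Qx Px ltnS sub_count.
Qed.

(** Induction on the number of points of [E] strictly between [p] and [q]: splitting at such a point
    [e] lowers the count on both sides, since [e] itself is lost. *)
Lemma finite_chain_le (R : realType) (E : set R) (g : R -> R -> R) :
  finite_set E -> (forall p q r, g p r <= g p q + g q r) ->
  (forall p q, E p -> E q -> p < q -> (forall e, E e -> ~ p < e < q) ->
    g p q <= q - p) ->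
  forall p q, E p -> E q -> p < q -> g p q <= q - p.
Proof.
move=> /finite_seqP[s ->] gD gE p q Ep Eq pq.
have [n] := ubnP (count (fun e => p < e < q) s).
elim: n p q Ep Eq pq => // n IHn p q Ep Eq pq; rewrite ltnS => count_n.
have [[e Ee /andP[pe eq]]|noe] := pselect (exists2 e, [set` s] e & p < e < q).
  have lt_count (c d : R) : p <= c -> d <= q -> ~~ (c < e < d)%R ->
      (count (fun t => (c < t < d)%R) s < n)%N.
    move=> pc dq cd; apply: leq_trans count_n.
    apply: (@count_lt_subpred _ _ _ _ e) => //; last by rewrite pe.
    by move=> t /andP[ct td]; rewrite (le_lt_trans pc ct) (lt_le_trans td dq).
  apply: le_trans (gD p e q) _.
  have -> : q - p = (e - p) + (q - e) by lra.
  apply: lerD; apply: IHn => //; apply: lt_count; rewrite ?lexx ?ltxx ?andbF//.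
  - exact: ltW.
  - exact: ltW.
by apply: gE => // e Ee peq; apply: noe; exists e.
Qed.

(** * Gaps of [F] and filled intervals *)

Lemma totally_disconnected_gap (R : realType) (F : set R) (c d : R) :
  totally_disconnected F -> c < d -> exists2 z, c < z < d & ~ F z.
Proof.
move=> tdF cd; apply: contrapT => no_gap.
have cdF : [set` `]c, d[] `<=` F.
  move=> t /=; rewrite in_itv/= => tcd; apply: contrapT => Ft.
  by apply: no_gap; exists t.
have [cm md] := midf_lt cd; set m := (c + d) / 2 in cm md.
have [cm' m'm] := midf_lt cm; set m' := (c + m) / 2 in cm' m'm.
have cdm : [set` `]c, d[] m by rewrite /= in_itv/= cm md.
have cdm' : [set` `]c, d[] m' by rewrite /= in_itv/= cm' (lt_trans m'm md).
have conn : connected [set` `]c, d[].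
  by apply/connected_intervalP; exact: interval_is_interval.
have := connected_component_max cdm cdF conn cdm'.
by rewrite (tdF _ (cdF _ cdm)) => /= E; rewrite E ltxx in m'm.
Qed.

(* If an endpoint e of a filled I of level n were in a lacunary J of a later
   level, points of J next to e outside I would be in no filled interval of
   level n, hence in a lacunary one, which is J by disjointness; but then J
   and I are two intervals of level n containing e. *)
Lemma endpoint_of_filled (R : realType) (F : set R) (a b : R)
    (Fn Ln : nat -> set (interval R))
    (Fn_closed : forall n I, Fn n I -> exists u v : R, I = `[u, v])
    (Ln_open : forall n I, Ln n I -> exists u v : R, I = `]u, v[)
    (F_eq : F = \bigcap_n \bigcup_(I in Fn n) [set` I])
    (Ln_incr : forall n, Ln n `<=` Ln n.+1)
    (In_finite : forall n, finite_set (Fn n `|` Ln n))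
    (In_partition : forall n,
       partition (Fn n `|` Ln n) (fun I => [set` I]) [set` `[a, b]])
    n I (e : R) :
  Fn n I -> e = inf [set` I] \/ e = sup [set` I] -> F e.
Proof.
move=> FnI eI.
have Ln_mono m k : (m <= k)%N -> Ln m `<=` Ln k.
  by move/subnK <-; elim: (k - m)%N => // j IH K /IH; exact: Ln_incr.
have [cov tri ne] := In_partition n.
have I0 : [set` I] !=set0 by apply: ne; left.
have cI : closed_or_open I.
  by have [u [v ->]] := Fn_closed _ _ FnI; exists u, v; left.
have Ie : e \in I.
  have [u [v Iuv]] := Fn_closed _ _ FnI.
  have uv : u <= v.
    by case: I0 => t; rewrite Iuv /= in_itv/= => /andP[ut /(le_trans ut)].
  by case: eI => ->; rewrite Iuv ?inf_itvcc ?sup_itvcc// in_itv/= lexx uv.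
have abe : e \in `[a, b].
  by suff : [set` `[a, b]] e by []; rewrite -cov; exists I => //; left.
rewrite F_eq => m _; have [covm _ _] := In_partition m.
have : [set` `[a, b]] e by [].
rewrite -covm => -[J [FmJ|LmJ] /= Je]; first by exists J.
exfalso.
(* At level [N], lacunary intervals of both levels [m] and [n] are present, so disjointness can
   compare them. *)
pose N := maxn m n.
have LNJ : Ln N J by apply: Ln_mono LmJ; exact: leq_maxl.
have [covN triN _] := In_partition N.
have [s [t Jst]] := Ln_open _ _ LmJ.
pose C := \bigcup_(I' in Fn n `\ I) [set` I'].
have closedC : closed C.
  apply: closed_bigcup.
    by apply: sub_finite_set (In_finite n) => I' [FnI' _]; left.
  move=> I' [FnI' _]; have [u' [v' ->]] := Fn_closed _ _ FnI'.
  exact: interval_closed.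
have Ce : (~` C) e.
  move=> [I' [FnI' I'I] /= I'e]; apply: I'I.
  by apply: (trivIset_itv_eq tri _ _ I'e Ie); left.
have : nbhs e (~` C `&` [set` J]).
  apply: filterI; apply: open_nbhs_nbhs; split => //.
    by rewrite openC.
  by rewrite Jst; exact: interval_open.
move=> /nbhs_ballP[r /= r0 ballr].
have [e' [er e'I]] : exists e', ball e r e' /\ e' \notin I.
  have [e'|e'] : e = inf [set` I] \/ e = sup [set` I] by [].
  - exists (e - r / 2); split.
      by rewrite /ball/= opprB addrC subrK gtr0_norm ?divr_gt0//; lra.
    by apply/negP => /(mem_ends_le cI); rewrite -e' => /andP[]; lra.
  - exists (e + r / 2); split.
      by rewrite /ball/= opprD addNKr normrN gtr0_norm ?divr_gt0//; lra.
    by apply/negP => /(mem_ends_le cI); rewrite -e' => /andP[]; lra.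
have [Ce' Je'] := ballr _ er.
have abe' : [set` `[a, b]] e' by rewrite -covN; exists J => //; right.
move: abe'; rewrite -cov => -[K [FnK|LnK] /= Ke'].
  apply: Ce'; exists K => //; split=> //= KI.
  by move: e'I; rewrite -KI Ke'.
have KJ : K = J.
  apply: (trivIset_itv_eq triN _ _ Ke' Je'); right => //.
  by apply: Ln_mono LnK; exact: leq_maxr.
have IJ : I = J.
  by apply: (trivIset_itv_eq tri _ _ Ie Je); [left|right; rewrite -KJ].
have [u [v Iuv]] := Fn_closed _ _ FnI.
by move: Iuv; rewrite IJ Jst.
Qed.

(** A point of a filled interval of level [m] that is not filled at level [n] is in a lacunary
    interval of level [n], which persists to level [m] and contradicts disjointness there. *)
Lemma not_filled_stable (R : realType) (a b : R)
    (Fn Ln : nat -> set (interval R))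
    (Fn_closed : forall n I, Fn n I -> exists u v : R, I = `[u, v])
    (Ln_open : forall n I, Ln n I -> exists u v : R, I = `]u, v[)
    (Ln_incr : forall n, Ln n `<=` Ln n.+1)
    (In_partition : forall n,
       partition (Fn n `|` Ln n) (fun I => [set` I]) [set` `[a, b]])
    n m (z : R) : (n <= m)%N ->
  ~ (\bigcup_(I in Fn n) [set` I]) z -> ~ (\bigcup_(I in Fn m) [set` I]) z.
Proof.
move=> nm zn [I FmI /= Iz]; apply: zn.
have Ln_mono : Ln n `<=` Ln m.
  by move/subnK : nm => <-; elim: (m - n)%N => // j IH K /IH; exact: Ln_incr.
have [covm trim _] := In_partition m; have [covn _ _] := In_partition n.
have : [set` `[a, b]] z by rewrite -covm; exists I => //; left.
rewrite -covn => -[J [FnJ|LnJ] /= Jz]; first by exists J.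
have IJ : I = J.
  by apply: (trivIset_itv_eq trim _ _ Iz Jz); [left|right; exact: Ln_mono].
have [u [v Iuv]] := Fn_closed _ _ FmI; have [s [t Jst]] := Ln_open _ _ LnJ.
(* Terms of type [interval R] carry their bound kinds, so a closed and an open interval are
   distinct. *)
by move: Iuv; rewrite IJ Jst.
Qed.

Lemma filled_endpoints_near (R : realType) (F : set R) (a b : R)
    (Fn Ln : nat -> set (interval R))
    (F_totdisc : totally_disconnected F)
    (Fn_closed : forall n I, Fn n I -> exists u v : R, I = `[u, v])
    (Ln_open : forall n I, Ln n I -> exists u v : R, I = `]u, v[)
    (F_eq : F = \bigcap_n \bigcup_(I in Fn n) [set` I])
    (Ln_incr : forall n, Ln n `<=` Ln n.+1)
    (In_partition : forall n,
       partition (Fn n `|` Ln n) (fun I => [set` I]) [set` `[a, b]])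
    (x y eps : R) : F x -> F y -> x < y -> 0 < eps ->
  exists n I J, [/\ Fn n I, Fn n J, x <= sup [set` I] < x + eps,
    y - eps < inf [set` J] <= y & sup [set` I] < inf [set` J]].
Proof.
move=> Fx Fy xy eps0.
(* The bound by half the distance puts [z] left of the midpoint of [x] and [y] and [w] right of it,
   which yields the final strict inequality. *)
pose h := Num.min eps ((y - x) / 2).
have h0 : 0 < h by rewrite lt_min eps0/= divr_gt0// subr_gt0.
have heps : h <= eps by rewrite ge_min lexx.
have hxy : h <= (y - x) / 2 by rewrite ge_min lexx orbT.
have [z /andP[xz zh] Fz] : exists2 z, x < z < x + h & ~ F z.
  by apply: totally_disconnected_gap => //; lra.
have [w /andP[wh wy] Fw] : exists2 w, y - h < w < y & ~ F w.
  by apply: totally_disconnected_gap => //; lra.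
have stable := not_filled_stable Fn_closed Ln_open Ln_incr In_partition.
have out t : ~ F t -> exists n, ~ (\bigcup_(I in Fn n) [set` I]) t.
  by rewrite F_eq => Ft; apply/existsNP => H; apply: Ft => n _; exact: H.
have [n1 /(stable _ _ _ (leq_maxl n1 _)) zn] := out _ Fz.
have [n2 /(stable _ _ _ (leq_maxr _ n2)) wn] := out _ Fw.
pose n := maxn n1 n2.
have [_ _ ne] := In_partition n.
have [I FnI /= Ix] : (\bigcup_(I in Fn n) [set` I]) x by move: Fx; rewrite F_eq; apply.
have [J FnJ /= Jy] : (\bigcup_(I in Fn n) [set` I]) y by move: Fy; rewrite F_eq; apply.
have co K : Fn n K -> closed_or_open K /\ [set` K] !=set0.
  move=> FnK; split; last by apply: ne; left.
  by have [u [v ->]] := Fn_closed _ _ FnK; exists u, v; left.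
have [[cI I0] [cJ J0]] := (co _ FnI, co _ FnJ).
have /andP[xI1 xI2] := mem_ends_le cI Ix; have /andP[yJ1 yJ2] := mem_ends_le cJ Jy.
(* Otherwise [z] would lie between [x] and the right end of [I], hence in a filled interval of level
   [n]. *)
have pz : sup [set` I] <= z.
  rewrite leNgt; apply/negP => zp; apply: (zn n2); exists I => //=.
  by apply: mem_between_ends => //; rewrite zp (le_lt_trans xI1).
have wq : w <= inf [set` J].
  rewrite leNgt; apply/negP => qw; apply: (wn n1); exists J => //=.
  by apply: mem_between_ends => //; rewrite qw (lt_le_trans wy).
by exists n, I, J; split => //; lra.
Qed.

(** * The distance estimate and the theorem *)

Lemma normc_le_lipschitz_opnorm (R : realType) (F : set R) (a b : R)
    (Fn Ln : nat -> set (interval R))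
    (F_totdisc : totally_disconnected F)
    (Fn_closed : forall n I, Fn n I -> exists u v : R, I = `[u, v])
    (Ln_open : forall n I, Ln n I -> exists u v : R, I = `]u, v[)
    (F_eq : F = \bigcap_n \bigcup_(I in Fn n) [set` I])
    (Ln_incr : forall n, Ln n `<=` Ln n.+1)
    (In_finite : forall n, finite_set (Fn n `|` Ln n))
    (In_partition : forall n,
       partition (Fn n `|` Ln n) (fun I => [set` I]) [set` `[a, b]])
    (f : R -> R[i]) (x y : R) :
  let cI := \bigcup_n (Fn n `|` Ln n) in
  lipschitz_fun F f -> (opnorm cI (comm_dom cI f) (comm_op f) <= 1)%E ->
  F x -> F y -> x < y -> normc (f y - f x) <= y - x.
Proof.
move=> cI [k lipf] f1 Fx Fy xy; apply/ler_addgt0Pr => e e0.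
(* Each of the two Lipschitz errors is then at most [e / 2]; the constant [k] may be zero or
   negative, so the positive constant [|k| + 1] replaces it. *)
pose eps := e / (2 * (`|k| + 1)).
have k1 : 0 < `|k| + 1 by rewrite ltr_wpDl.
have eps0 : 0 < eps by rewrite divr_gt0// mulr_gt0.
have lip s t h : F s -> F t -> `|s - t| <= h ->
    normc (f s - f t) <= (`|k| + 1) * h.
  move=> Fs Ft sth; apply: le_trans (lipf _ _ Fs Ft) _.
  apply: le_trans (_ : (`|k| + 1) * `|s - t| <= _); last by rewrite ler_pM2l.
  apply: ler_wpM2r => //; have := ler_norm k; lra.
have [n [I [J [FnI FnJ /andP[xp px] /andP[yq qy] pq]]]] :=
  filled_endpoints_near F_totdisc Fn_closed Ln_open F_eq Ln_incr In_partition
    Fx Fy xy eps0.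
set p := sup _ in xp px pq; set q := inf _ in yq qy pq.
have in_F := endpoint_of_filled Fn_closed Ln_open F_eq Ln_incr In_finite In_partition.
have Fp : F p by apply: (in_F _ _ _ FnI); right.
have Fq : F q by apply: (in_F _ _ _ FnJ); left.
have co m K : (Fn m `|` Ln m) K -> closed_or_open K.
  move=> [/Fn_closed|/Ln_open] [u [v ->]]; exists u, v; [by left|by right].
have chain : normc (f q - f p) <= q - p.
  apply: (finite_chain_le (g := fun s t => normc (f t - f s))
      (finite_endpoints (In_finite n))) => //.
  - by move=> s t r; rewrite [leRHS]addrC; exact: normc_distD.
  - move=> s t Es Et st nobetween.
    have /andP[as_ _] := endpoint_le (In_partition n) (@co n) Es.
    have /andP[_ tb] := endpoint_le (In_partition n) (@co n) Et.
    have [K [IK Ks Kt]] := consecutive_endpoints (In_partition n) (@co n) Es Et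
      as_ st tb nobetween.
    have := opnorm_comm_le1 f1 (_ : cI K); rewrite /itv_length Ks Kt; apply.
      by exists n.
    by rewrite subr_gt0.
  - by right; exists I => //; left.
  - by left; exists J => //; left.
have fpx : normc (f p - f x) <= e / 2.
  apply: le_trans (lip p x eps Fp Fx _) _.
    by rewrite ger0_norm ?subr_ge0//; lra.
  rewrite /eps le_eqVlt; apply/orP; left; apply/eqP; field.
  by rewrite gt_eqF.
have fyq : normc (f y - f q) <= e / 2.
  apply: le_trans (lip y q eps Fy Fq _) _.
    by rewrite ger0_norm ?subr_ge0//; lra.
  rewrite /eps le_eqVlt; apply/orP; left; apply/eqP; field.
  by rewrite gt_eqF.
have := normc_distD (f y) (f q) (f x); have := normc_distD (f q) (f p) (f x).
by lra.
Qed.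

Theorem theorem4p5 (R : realType) (F : set R) (a b : R)
    (Fn Ln : nat -> set (interval R))
    (F_nonempty : F !=set0)
    (F_compact : compact F)
    (F_totdisc : totally_disconnected F)
    (F_noisol : isolated F = set0)
    (F_hull : convex_hull F = [set` `[a, b]])
    (Fn_closed : forall n I, Fn n I -> exists u v : R, I = `[u, v])
    (Ln_open : forall n I, Ln n I -> exists u v : R, I = `]u, v[)
    (F_eq : F = \bigcap_n \bigcup_(I in Fn n) [set` I])
    (Ln_incr : forall n, Ln n `<=` Ln n.+1)
    (In_finite : forall n, finite_set (Fn n `|` Ln n))
    (In_partition : forall n,
       partition (Fn n `|` Ln n) (fun I => [set` I]) [set` `[a, b]])
    (x y : R) (Fx : F x) (Fy : F y) :
  let cI := \bigcup_n (Fn n `|` Ln n) in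
  ereal_sup [set (ComplexField.Normc.normc (f x - f y))%:E |
      f in [set f | lipschitz_fun F f /\
                    (opnorm cI (comm_dom cI f) (comm_op f) <= 1)%E]]
  = (`|x - y|)%:E.
Proof.
move=> cI; apply/le_anti/andP; split.
  apply: ge_ereal_sup => _ [f [lipf f1] <-]; rewrite lee_fin.
  have le_dist := normc_le_lipschitz_opnorm F_totdisc Fn_closed Ln_open F_eq
    Ln_incr In_finite In_partition lipf f1.
  have [xy|yx|->] := ltgtP x y.
  - by rewrite normc_distC ltr0_norm ?subr_lt0// opprB; exact: le_dist.
  - by rewrite gtr0_norm ?subr_gt0//; exact: le_dist.
  - by rewrite subrr ComplexField.Normc.normc0.
(* The identity function attains the supremum. *)
apply: ereal_sup_ubound; exists (fun t => t%:C%C); last first.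
  by rewrite -raddfB normc_real.
split; last exact: opnorm_comm_id.
by exists 1 => s t _ _; rewrite -raddfB normc_real mul1r.
Qed.
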